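(* Let $\operatorname{Spec}(A)$ be an affine $\mathbb{G}_a$-variety over $k$ with action $\beta$ such that $A$ is generated by $z_1,\dots,z_n$ as a $k$-algebra, let $\beta^\sharp(z_i)=v_i(Z,t)$ for $1\le i\le n$, and let $(g,h)$ be a principle pair with $h\neq 0$. Then the rational functions $$f_i(Z)=v_i(z_1,\dots,z_n,-g/h),\qquad 1\le i\le n,$$ are invariant.
   Context: $k$ is an algebraically closed field (of any characteristic) and $\mathbb{G}_a=\operatorname{Spec}(k[t])$. Varieties are integral separated schemes of finite type over $k$. The co-action is $\beta^\sharp:A\to A[t]$; $v_i(Z,t)\in A[t]$ denotes $\beta^\sharp(z_i)$ written in terms of $Z=(z_1,\dots,z_n)$ and $t$, and $v_i(Z,-g/h)\in A_h$ is obtained by substituting $t=-g/h$. A principle pair is a pair $(g,h)$ with $g\in A$, $h\in A^{\mathbb{G}_a}$ and $\beta^\sharp(g)=g+t\,h$. *)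

(* Defs.v *)
From HB Require Import structures.
From mathcomp Require Import all_boot all_algebra.
From mathcomp Require Export mpoly.

Set Implicit Arguments.
Unset Strict Implicit.
Unset Printing Implicit Defensive.

Import GRing.Theory.
Local Open Scope ring_scope.
Local Open Scope quotient_scope.

(* MathComp has no join of idomainType and algType; note that {poly A} is only
   an algebra over A, so k-linearity of maps into A[t] is stated by hand. *)
#[short(type="domainAlgType")]
HB.structure Definition DomainAlgebra (R : nzRingType) :=
  {A of GRing.IntegralDomain A & GRing.Algebra R A}.

Notation "x %:F" := (@FracField.tofrac _ x) : ring_scope.

Section Coaction.

Variables (k : closedFieldType) (A : domainAlgType k).

Definition generated_by n (z : 'I_n -> A) : Prop :=
  forall a : A, exists p : {mpoly k[n]}, a = mmap (GRing.in_alg A) z p.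

(* The comorphism of a G_a-action on Spec A, where G_a = Spec k[t] has counit
   t |-> 0 and comultiplication t |-> s + t.  A[s, t] is {poly {poly A}}, so
   map_poly beta \o beta is (beta (x) id) \o beta and poly_XaY is id (x) Delta. *)
Definition Ga_coaction (beta : {rmorphism A -> {poly A}}) : Prop :=
  [/\ forall c : k, beta c%:A = (c%:A)%:P,
      forall a : A, (beta a).[0] = a
    & forall a : A, map_poly beta (beta a) = poly_XaY (beta a)].

Definition Ga_invariant (beta : A -> {poly A}) (a : A) : Prop :=
  beta a = a%:P.

Definition principle_pair (beta : A -> {poly A}) (g h : A) : Prop :=
  Ga_invariant beta h /\ beta g = g%:P + 'X * h%:P.

End Coaction.

(* The extension a / b |-> phi a / phi b of phi to fraction fields; it is
   meaningful for injective phi, see frac_pullback_div. *)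
Definition frac_pullback (A B : idomainType) (phi : A -> B)
    (f : {fraction A}) : {fraction B} :=
  (phi \n_(repr f))%:F / (phi \d_(repr f))%:F.

Lemma frac_repr (A : idomainType) (f : {fraction A}) :
  f = (\n_(repr f))%:F / (\d_(repr f))%:F.
Proof.
have d0 := denom_ratioP (repr f).
have dF : (\d_(repr f))%:F != 0 :> {fraction A} by rewrite tofrac_eq0.
apply: (canRL (mulfK dF)).
rewrite -{1}[f]reprK.
rewrite /FracField.tofrac; unlock.
rewrite !piE; apply/eqP; rewrite piE /=.
rewrite FracField.equivfE /FracField.mulf.
by rewrite !numden_Ratio ?mulr1 ?oner_neq0 // mulrC.
Qed.

Lemma frac_pullback_div (A B : idomainType) (phi : {rmorphism A -> B})
    (a b : A) : injective phi -> b != 0 ->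
  frac_pullback phi (a%:F / b%:F) = (phi a)%:F / (phi b)%:F.
Proof.
move=> phiI b0; set f := a%:F / b%:F.
have phi0 x : x != 0 -> (phi x)%:F != 0 :> {fraction B}.
  by move=> x0; rewrite tofrac_eq0 -(rmorph0 phi) (inj_eq phiI).
have d0 := denom_ratioP (repr f).
have /eqP := frac_repr f; rewrite {1}/f eqr_div ?tofrac_eq0 //.
rewrite -!tofracM tofrac_eq => /eqP E.
by apply/eqP; rewrite eqr_div ?phi0 // -!tofracM -!rmorphM E.
Qed.

(* A rational function f on X = Spec A is invariant when its pullbacks to
   X x G_a along the action and along the first projection agree in
   k(X x G_a) = Frac A[t].  Both comorphisms, beta and polyC, are injective. *)
Definition rational_invariant (k : closedFieldType) (A : domainAlgType k)
    (beta : A -> {poly A}) (f : {fraction A}) : Prop :=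
  frac_pullback beta f = frac_pullback (@polyC A) f.

Lemma Ga_coaction_inj (k : closedFieldType) (A : domainAlgType k)
    (beta : {rmorphism A -> {poly A}}) : Ga_coaction beta -> injective beta.
Proof. by case=> _ counit _ a b E; rewrite -(counit a) E counit. Qed.

(* Main.v *)
(** Let [beta] and the constant inclusion [polyC] act on fractions. The action
    sends [g/h] to [g/h + t], and coassociativity turns the action on the
    coefficients of [v_i] into the substitution of [s + t] for the variable.
    At [s = -(g/h + t)] the two shifts cancel, leaving [v_i(Z, -g/h)]. *)
Require Import Defs.
From HB Require Import structures.
From mathcomp Require Import all_boot all_algebra.
From mathcomp Require Import mpoly.
Import GRing.Theory.
Local Open Scope ring_scope.

Section FracPullback.

Variables (A B : idomainType) (phi : {rmorphism A -> B}).
Hypothesis phi_inj : injective phi.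

Lemma tofrac_morph_neq0 (a : A) : a != 0 -> (phi a)%:F != 0 :> {fraction B}.
Proof. by move=> a0; rewrite tofrac_eq0 -(rmorph0 phi) (inj_eq phi_inj). Qed.

(** Trades the chosen representative inside [frac_pullback] for an explicit quotient, to which
    [frac_pullback_div] applies. *)
Lemma fractionP_div (f : {fraction A}) :
  exists a, exists2 b, b != 0 & f = a%:F / b%:F.
Proof.
by exists \n_(repr f), \d_(repr f); [exact: denom_ratioP | exact: frac_repr].
Qed.

Lemma frac_pullback_tofrac (a : A) : frac_pullback phi a%:F = (phi a)%:F.
Proof.
have := frac_pullback_div a phi_inj (oner_neq0 A).
by rewrite (rmorph1 phi) !tofrac1 !divr1.
Qed.

Lemma frac_pullbackD : {morph frac_pullback phi : x y / x + y}.
Proof.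
move=> x y; have [a [b b0 ->]] := fractionP_div x; have [c [d d0 ->]] := fractionP_div y.
rewrite addf_div ?tofrac_eq0 // -!tofracM -tofracD.
rewrite !frac_pullback_div ?mulf_neq0 // addf_div ?tofrac_morph_neq0 //.
by rewrite (rmorphD phi) !(rmorphM phi) tofracD !tofracM.
Qed.

Lemma frac_pullbackM : {morph frac_pullback phi : x y / x * y}.
Proof.
move=> x y; have [a [b b0 ->]] := fractionP_div x; have [c [d d0 ->]] := fractionP_div y.
rewrite mulf_div -!tofracM !frac_pullback_div ?mulf_neq0 // mulf_div.
by rewrite !(rmorphM phi) !tofracM.
Qed.

(** Compatibility with sums and products carries the pullback through Horner's scheme: [phi] acts on
    the coefficients, [frac_pullback phi] on the point. *)
Lemma frac_pullback_horner (p : {poly A}) (x : {fraction A}) :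
  frac_pullback phi (map_poly (@FracField.tofrac A) p).[x]
  = (map_poly (@FracField.tofrac B) (map_poly phi p)).[frac_pullback phi x].
Proof.
elim/poly_ind: p => [|p c IHp].
  by rewrite !(map_poly0, horner0) -tofrac0 frac_pullback_tofrac (rmorph0 phi) tofrac0.
rewrite !(rmorphD, rmorphM) /= !map_polyX !map_polyC /= !hornerMXaddC.
by rewrite frac_pullbackD frac_pullbackM IHp frac_pullback_tofrac.
Qed.

End FracPullback.

Theorem proposition5p1 (k : closedFieldType) (A : domainAlgType k)
    (beta : {rmorphism A -> {poly A}}) (beta_coaction : Ga_coaction beta)
    (n : nat) (z : 'I_n -> A) (z_gen : generated_by z)
    (v : 'I_n -> {poly A}) (beta_z : forall i, beta (z i) = v i)
    (g h : A) (gh_pair : principle_pair beta g h) (h_neq0 : h != 0) :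
  forall i : 'I_n,
    rational_invariant beta
      (map_poly (@FracField.tofrac A) (v i)).[- (g%:F / h%:F)].
Proof.
move=> i; rewrite /rational_invariant.
have beta_inj := Ga_coaction_inj beta_coaction.
have [_ _ coassoc] := beta_coaction; have [beta_h beta_g] := gh_pair.
have hC0 : (h%:P)%:F != 0 :> {fraction {poly A}}.
  by rewrite tofrac_eq0 polyC_eq0.
(* The sign moves into the numerator so that the point is a quotient of elements of [A]. *)
rewrite -mulNr -tofracN (frac_pullback_horner _ _ _ beta_inj).
rewrite (frac_pullback_horner _ _ _ (@polyC_inj A)).
rewrite !frac_pullback_div //; last exact: polyC_inj.
(* Coassociativity replaces the twisted coefficients by constant ones, at the cost of adding the
   inner variable $t$ to the point. *)
rewrite -beta_z coassoc /poly_XaY map_comp_poly horner_comp.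
rewrite rmorphD /= map_polyX map_polyC /= hornerD hornerX hornerC.
(* Both sides evaluate the same polynomial, so only the points remain: $-(g+th)/h+t=-g/h$. *)
congr (_.[_]).
rewrite rmorphN /= beta_h beta_g !tofracN tofracD tofracM polyCN tofracN.
by rewrite opprD mulrDl !mulNr mulfK // subrK.
Qed.
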